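(* Let $\mathbb{F}:\Omega\to H_1$ be a continuous frame associated to $(a_2,\dots,a_n)$ with respect to $(\Omega,\mu)$ for $H_1$ with frame operator $S_C$, and let $U:H_F\to H_F$ be a bounded and invertible operator. Then $U\mathbb{F}$, $w\mapsto U(\mathbb{F}(w))$, is a continuous frame associated to $(a_2,\dots,a_n)$ with frame operator $U S_C U^*$.
   Context: Let $n\ge 2$. An $n$-inner product on a complex vector space $H$ with $\dim H\ge n$ is a map $(x,y,x_2,\dots,x_n)\mapsto\langle x,y\mid x_2,\dots,x_n\rangle\in\mathbb{C}$ such that: (i) $\langle x_1,x_1\mid x_2,\dots,x_n\rangle\ge 0$, with equality iff $x_1,\dots,x_n$ are linearly dependent; (ii) it is invariant under permutations of $x_2,\dots,x_n$; (iii) $\langle x,y\mid x_2,\dots,x_n\rangle=\overline{\langle y,x\mid x_2,\dots,x_n\rangle}$; (iv), (v) it is linear in $x$. The induced $n$-norm is $\|x_1,x_2,\dots,x_n\|=\langle x_1,x_1\mid x_2,\dots,x_n\rangle^{1/2}$. $H$ is an $n$-Hilbert space if it is complete: every sequence $(x_k)$ with $\|x_l-x_k,e_2,\dots,e_n\|\to0$ for all $e_2,\dots,e_n\in H$ has some $x\in H$ with $\|x_k-x,e_2,\dots,e_n\|\to 0$ for all $e_2,\dots,e_n\in H$. $H_1$ is a complex $n$-Hilbert space and $a_2,\dots,a_n\in H_1$ are fixed linearly independent elements. Let $L_F=\operatorname{span}\{a_2,\dots,a_n\}$ (the subscript $F$ refers to the set $\{a_2,\dots,a_n\}$). The form $\langle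 x+L_F,y+L_F\rangle_F=\langle x,y\mid a_2,\dots,a_n\rangle$ is an inner product on $H_1/L_F$; $H_F$ denotes its Hilbert space completion. Elements of $H_1$ are identified with their images in $H_F$, and $\langle\cdot,\cdot\mid a_2,\dots,a_n\rangle$ and $\|\cdot,a_2,\dots,a_n\|$ also denote the inner product and norm of $H_F$. Let $(\Omega,\mu)$ be a measure space with positive measure. A mapping $\mathbb{F}:\Omega\to H_1$ is a continuous frame associated to $(a_2,\dots,a_n)$ with respect to $(\Omega,\mu)$ for $H_1$ if for every $f\in H_1$ the function $w\mapsto\langle f,\mathbb{F}(w)\mid a_2,\dots,a_n\rangle$ is measurable and there are constants $0<A\le B<\infty$ with $$A\|f,a_2,\dots,a_n\|^2\le\int_\Omega|\langle f,\mathbb{F}(w)\mid a_2,\dots,a_n\rangle|^2d\mu(w)\le B\|f,a_2,\dots,a_n\|^2\quad\text{for all } f\in H_1.$$ For a mapping with values in $H_F$ (such as $U\mathbb{F}$) the term means the same two conditions with $f$ ranging over $H_F$. The frame operator $S_C:H_F\to H_F$ of a continuous frame $\mathbb{F}$ is determined by $$\langle S_Cf,g\mid a_2,\dots,a_n\rangle=\int_\Omega\langle f,\mathbb{F}(w)\mid a_2,\dots,a_n\rangle\,\langle\mathbb{F}(w),g\mid a_2,\dots,a_n\rangle\,d\mu(w),\quad f,g\in H_F.$$ $U^*$ is the Hilbert space adjoint of $U$ on $H_F$. *)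

(* Defs.v *)
From HB Require Import structures.
From mathcomp Require Import all_boot all_order all_algebra.
From mathcomp Require Import generic_quotient ring_quotient.
From mathcomp Require Import all_classical all_reals all_analysis.
From mathcomp Require Import complex ring.

Set Implicit Arguments.
Unset Strict Implicit.
Unset Printing Implicit Defensive.

Import Order.TTheory GRing.Theory Num.Theory.
Import numFieldNormedType.Exports.

Local Open Scope classical_set_scope.
Local Open Scope ring_scope.
Local Open Scope complex_scope.

Section LinearAlgebra.
Context {K : fieldType} {V : lmodType K}.

Definition lin_dep k (x : k.-tuple V) : Prop :=
  exists2 c : 'I_k -> K, (exists i, c i != 0) & \sum_i c i *: tnth x i = 0.

Definition lin_indep k (x : k.-tuple V) : Prop := ~ lin_dep x.

Definition dim_ge (k : nat) : Prop := exists x : k.-tuple V, lin_indep x.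

Definition lin_span k (x : k.-tuple V) : pred V :=
  fun v => `[< exists c : 'I_k -> K, v = \sum_i c i *: tnth x i >].

Lemma lin_span_submod k (x : k.-tuple V) : submod_closed (lin_span x).
Proof.
split.
  apply/asboolP; exists (fun=> 0).
  by rewrite big1 // => i _; rewrite scale0r.
move=> b u v /asboolP[c ->] /asboolP[e ->]; apply/asboolP.
exists (fun i => b * c i + e i); rewrite scaler_sumr -big_split /=.
by apply: eq_bigr => i _; rewrite scalerDl scalerA.
Qed.

HB.instance Definition _ k (x : k.-tuple V) :=
  GRing.isSubmodClosed.Build K V (lin_span x) (lin_span_submod x).

End LinearAlgebra.
Arguments dim_ge {K} V k.

(* [Quotient.quot] only comes with its additive group structure. *)
Section QuotientBySpan.
Context {K : fieldType} {V : lmodType K}.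
Variables (k : nat) (x : k.-tuple V).
Local Open Scope quotient_scope.
Local Notation quotL := (@Quotient.quot V (GRing.ZmodClosed.clone V (lin_span x) _)).

Definition quot_span : Type := quotL.
HB.instance Definition _ := GRing.Zmodule.on quot_span.

Definition quot_class (v : V) : quot_span := \pi_(quotL) v.
Definition quot_repr (u : quot_span) : V := repr (u : quotL).

Lemma quot_reprK u : quot_class (quot_repr u) = u.
Proof. exact: reprK. Qed.

Lemma quot_classE u v : (quot_class u = quot_class v) <-> (u - v \in lin_span x).
Proof.
rewrite -Quotient.equivE; split=> [h|h]; first by rewrite Quotient.equivE Quotient.idealrBE; apply/eqP.
by apply/eqP; rewrite -[_ == _]Quotient.idealrBE.
Qed.

Lemma quot_class_is_zmod_morphism : zmod_morphism quot_class.
Proof. by move=> u v; rewrite /quot_class raddfB. Qed.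

Definition quot_scale (c : K) (u : quot_span) : quot_span :=
  quot_class (c *: quot_repr u).

Lemma quot_scaleE c v : quot_scale c (quot_class v) = quot_class (c *: v).
Proof.
by apply/quot_classE; rewrite -scalerBr rpredZ //; apply/quot_classE; rewrite quot_reprK.
Qed.

HB.instance Definition _ :=
  GRing.isZmodMorphism.Build V quot_span quot_class quot_class_is_zmod_morphism.

Lemma quot_scaleA b c u : quot_scale b (quot_scale c u) = quot_scale (b * c) u.
Proof. by rewrite -[u]quot_reprK !quot_scaleE scalerA. Qed.
Lemma quot_scale1 : left_id 1 quot_scale.
Proof. by move=> u; rewrite -[u]quot_reprK quot_scaleE scale1r. Qed.
Lemma quot_scaleDr : right_distributive quot_scale +%R.
Proof.
move=> c u v; rewrite -[u]quot_reprK -[v]quot_reprK -raddfD !quot_scaleE.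
by rewrite scalerDr raddfD.
Qed.
Lemma quot_scaleDl u : {morph quot_scale^~ u : b c / b + c}.
Proof.
by move=> b c; rewrite -[u]quot_reprK !quot_scaleE scalerDl raddfD.
Qed.

HB.instance Definition _ := GRing.Zmodule_isLmodule.Build K quot_span
  quot_scaleA quot_scale1 quot_scaleDr quot_scaleDl.

Lemma quot_class_is_scalable : scalable quot_class.
Proof. by move=> c v; rewrite -quot_scaleE. Qed.

HB.instance Definition _ :=
  GRing.isScalable.Build K V quot_span *:%R quot_class quot_class_is_scalable.

End QuotientBySpan.

Section NInnerProduct.
Variables (R : realType) (n : nat) (H : lmodType R[i]).

(* The order of [R[i]] makes [0 <= z] say that [z] is real and nonnegative. *)
Record nInnerProduct := NInnerProduct {
  nip :> H -> H -> n.-1.-tuple H -> R[i];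
  nip_ge0 : forall x s, 0 <= nip x x s;
  nip_eq0 : forall x s, nip x x s = 0 <-> lin_dep [tuple of x :: s];
  nip_perm : forall x y (s t : n.-1.-tuple H),
    perm_eq s t -> nip x y s = nip x y t;
  nip_conj : forall x y s, nip x y s = Num.conj (nip y x s);
  nipZ : forall c x y s, nip (c *: x) y s = c * nip x y s;
  nipD : forall x x' y s, nip (x + x') y s = nip x y s + nip x' y s
}.

End NInnerProduct.

Definition form_norm (R : realType) (V : Type) (form : V -> V -> R[i]) (x : V) : R :=
  Num.sqrt (complex.Re (form x x)).

Section NHilbert.
Variables (R : realType) (n : nat) (H : lmodType R[i]).
Variable ip : nInnerProduct n H.

Definition form_at (a : n.-1.-tuple H) (x y : H) : R[i] := ip x y a.

Definition nnorm (x : H) (s : n.-1.-tuple H) : R := form_norm (form_at s) x.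

Definition nhilbert : Prop := forall x : nat -> H,
  (forall e, nnorm (x p.1 - x p.2) e @[p --> (\oo, \oo)] --> (0 : R)) ->
  exists l : H, forall e, nnorm (x k - l) e @[k --> \oo] --> (0 : R).

Variable a : n.-1.-tuple H.

(* The value does not depend on the representatives, see [quot_formE]. *)
Definition quot_form (u v : quot_span a) : R[i] :=
  ip (quot_repr u) (quot_repr v) a.

Lemma nip_spanl l y : l \in lin_span a -> ip l y a = 0.
Proof.
move=> la.
have l0 : ip l l a = 0.
  apply/nip_eq0; move/asboolP: la => [c lE].
  exists (fun i => if unlift ord0 i is Some j then - c j else 1).
    by exists ord0; rewrite unlift_none oner_eq0.
  rewrite big_ord_recl unlift_none scale1r tnth0 lE.
  rewrite -big_split big1 // => i _ /=.
  by rewrite liftK tnthS scaleNr subrr.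
apply/eqP; apply: contraT => z0.
set z := ip l y a in z0; set q := ip y y a.
have q0 : 0 <= q := nip_ge0 ip y a.
have qC : Num.conj q = q by rewrite -nip_conj.
pose t := - (q + 1) / z.
have tz : t * z = - (q + 1) by rewrite /t divfK.
have nipDr x u v : ip x (u + v) a = ip x u a + ip x v a.
  by rewrite (nip_conj ip) nipD rmorphD /= -!(nip_conj ip).
have nipZr x c v : ip x (c *: v) a = Num.conj c * ip x v a.
  by rewrite (nip_conj ip) nipZ rmorphM /= -(nip_conj ip).
have := nip_ge0 ip (t *: l + y) a.
rewrite !nipD !nipDr !nipZ !nipZr l0 !mulr0 add0r -/z tz -/q.
have -> : Num.conj t * ip y l a = - (q + 1).
  rewrite (nip_conj ip) -/z -rmorphM tz rmorphN rmorphD rmorph1.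
  by congr (- (_ + _)).
have -> : - (q + 1) + (- (q + 1) + q) = - (q + 2).
  by ring.
rewrite oppr_ge0 => /(lt_le_trans (ltr_wpDl q0 (ltr0Sn _ 1))).
by rewrite ltxx.
Qed.

Lemma quot_formE x y :
  quot_form (quot_class a x) (quot_class a y) = ip x y a.
Proof.
have h w : quot_repr (quot_class a w) - w \in lin_span a.
  by apply/quot_classE; rewrite quot_reprK.
have e u v w : u - v \in lin_span a -> ip u w a = ip v w a.
  by move=> uv; rewrite -[u](subrK v) nipD nip_spanl // add0r.
rewrite /quot_form (e _ _ _ (h x)) (nip_conj ip) (e _ _ _ (h y)).
by rewrite -(nip_conj ip).
Qed.

End NHilbert.

Section HilbertSpace.
Variables (R : realType) (K : completeNormedModType R[i]).
Variable form : {dot K for Num.conj}.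

(* [K] is a Hilbert space for [form]: the norm of the complete space [K] is
   the one [form] induces. *)
Definition hilbert : Prop := forall x : K, `|x| = sqrtC (form x x).

Definition bounded_op (U : K -> K) : Prop :=
  exists M : R, forall x, `|U x| <= M%:C * `|x|.

Definition is_adjoint (U V : K -> K) : Prop :=
  forall x y, form (U x) y = form x (V y).

(* The adjoint of a bounded linear operator exists and is unique; the default
   value is only met on other functions. *)
Definition adjoint (U : K -> K) : K -> K :=
  xget (fun=> 0) [set V | is_adjoint U V].

(* [K], with the embedding [j], is a Hilbert space completion of the
   inner product space [(Q, q)]. *)
Definition is_completion (Q : lmodType R[i]) (q : Q -> Q -> R[i])
    (j : {linear Q -> K}) : Prop :=
  [/\ hilbert, forall u v, form (j u) (j v) = q u v & dense (range j)].

End HilbertSpace.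

Section ComplexIntegral.
Context {d : measure_display} {Omega : measurableType d} {R : realType}.
Variable mu : {measure set Omega -> \bar R}.

Definition cmeasurable (f : Omega -> R[i]) : Prop :=
  measurable_fun setT (fun w => complex.Re (f w)) /\
  measurable_fun setT (fun w => complex.Im (f w)).

Definition cintegrable (f : Omega -> R[i]) : Prop :=
  mu.-integrable setT (fun w => (complex.Re (f w))%:E) /\
  mu.-integrable setT (fun w => (complex.Im (f w))%:E).

Definition cintegral (f : Omega -> R[i]) : R[i] :=
  (\int[mu]_w complex.Re (f w)) +i* (\int[mu]_w complex.Im (f w)).

End ComplexIntegral.

Section Frames.
Context {d : measure_display} {Omega : measurableType d} {R : realType}.
Variable mu : {measure set Omega -> \bar R}.

(* [form] is [form_at ip a] for a mapping into the n-Hilbert space itself, and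
   the inner product of the completion for a mapping into the completion. *)
Definition continuous_frame (V : Type) (form : V -> V -> R[i])
    (F : Omega -> V) : Prop :=
  (forall f, cmeasurable (fun w => form f (F w))) /\
  exists A B : R, [/\ 0 < A, A <= B & forall f,
    ((A * form_norm form f ^+ 2)%:E
       <= \int[mu]_w (Normc.normc (form f (F w)) ^+ 2)%:E
       <= (B * form_norm form f ^+ 2)%:E)%E].

Definition is_frame_operator (V : Type) (form : V -> V -> R[i])
    (F : Omega -> V) (S : V -> V) : Prop :=
  forall f g, cintegrable mu (fun w => form f (F w) * form (F w) g) /\
    form (S f) g = cintegral mu (fun w => form f (F w) * form (F w) g).

End Frames.

(* Main.v *)
Require Import Defs.
From HB Require Import structures.
From mathcomp Require Import all_boot all_order all_algebra.
From mathcomp Require Import all_classical all_reals all_analysis.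
From mathcomp Require Import measurable_realfun complex.
From mathcomp Require Import ring lra.

Set Implicit Arguments.
Unset Strict Implicit.
Unset Printing Implicit Defensive.

Import Order.TTheory GRing.Theory Num.Theory.
Import numFieldNormedType.Exports.

Local Open Scope classical_set_scope.
Local Open Scope ring_scope.

(** The key identity is [form f (U x) = form (U^* f) x].  It turns every
    coefficient of [U F] into a coefficient of [F] taken at [U^* f], so the
    frame operator of [U F] is read off the one of [F] at [U^* f] and [U^* g],
    and the frame inequality of [U F] at [f] is the one of [F] at [U^* f].
    The latter is comparable with an inequality at [f] because
    [c |f| <= |U^* f| <= C |f|].  This argument rests on three facts.

    - The adjoint exists.  By Riesz representation, the bounded real functional
      [phi x = Re (form (U x) y)] is represented by the point where
      [|z|^2 - 2 phi z] is minimal ([riesz_re], [adjointP]).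

    - [U^*] is bounded below ([adjoint_bounded_below]).  The vectors [f] with
      [|U^* f| <= 1] are bounded as functionals at each point [U x], hence, [U]
      being onto, at every point; the uniform boundedness principle makes them
      norm bounded.  This replaces the open mapping theorem for [U].  The
      uniform boundedness principle is proved by a gliding hump, which needs
      only limits of explicit Cauchy sequences ([uniform_boundedness]).

    - A frame for [H1] is a frame for its completion
      ([continuous_frame_dense]).  The vectors of [H1] are dense.  Coefficients
      at a limit vector are pointwise limits of coefficients at vectors of
      [H1], so they are measurable, and Fatou's lemma bounds their energy, that
      is, the integral of the squared moduli.  The
      lower bound follows by comparing the energy of [f] with that of a
      sufficiently close vector [g] of [H1], the energy of [g - f] being
      controlled by the upper bound.  The constants that come out are not the
      best ones, but a frame asks for no more than their existence.

    Almost everything is done with the real inner product [Re (form x y)], the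
    imaginary part of [form x y] being its value at [- i x] and [y]. *)

(** * Complex numbers and discriminants *)

Section RealPart.
Context {R : realType}.
Implicit Types z w : R[i].

Lemma Re_conj z : complex.Re (Num.conj z) = complex.Re z.
Proof. by case: z. Qed.

Lemma ReD z w : complex.Re (z + w) = complex.Re z + complex.Re w.
Proof. by case: z; case: w. Qed.

Lemma ReN z : complex.Re (- z) = - complex.Re z.
Proof. by case: z. Qed.

Lemma ReM z (t : R) : complex.Re (t%:C%C * z) = t * complex.Re z.
Proof. by case: z => x y /=; rewrite mul0r subr0. Qed.

Lemma Re_mulN z : complex.Re (- 'i%C * z) = complex.Im z.
Proof. by case: z => x y /=; rewrite oppr0 mul0r add0r mulN1r opprK. Qed.

Lemma sqr_normcE z : Normc.normc z ^+ 2 = complex.Re z ^+ 2 + complex.Im z ^+ 2.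
Proof. by case: z => x y /=; rewrite sqr_sqrtr// addr_ge0// sqr_ge0. Qed.

(** The sign of [a t^2 + 2 b t + c] at its minimum [- b / a] gives the bound;
    it yields both Cauchy-Schwarz and the Euler equation of a minimisation. *)
Lemma discr_le (a b c : R) : 0 <= a ->
  (forall t, 0 <= a * t ^+ 2 + 2 * b * t + c) -> b ^+ 2 <= a * c.
Proof.
move=> a0 h; have [a_eq0|an0] := eqVneq a 0.
  have [->|bn0] := eqVneq b 0; first by rewrite a_eq0 expr0n mul0r.
  have := h (- (c + 1) / (2 * b)).
  rewrite a_eq0 mul0r add0r mulrCA divff ?mulr1 ?mulf_neq0 ?pnatr_eq0//.
  lra.
have a_gt0 : 0 < a by rewrite lt_def an0.
have := h (- b / a).
have -> : a * (- b / a) ^+ 2 + 2 * b * (- b / a) + c = (a * c - b ^+ 2) / a.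
  by field.
by rewrite pmulr_lge0 ?invr_gt0// subr_ge0.
Qed.
End RealPart.

(** * Geometry of a complex Hilbert space seen as a real one *)

Section HilbertGeometry.
Context {R : realType} {K : completeNormedModType R[i]}.
Variable form : {dot K for Num.conj}.

Definition re_dot (x y : K) : R := complex.Re (form x y).
Local Notation N := (form_norm form).

Lemma formC x y : form x y = Num.conj (form y x).
Proof. by rewrite hermC expr0 mul1r. Qed.
Lemma re_dotC x y : re_dot x y = re_dot y x.
Proof. by rewrite /re_dot formC Re_conj. Qed.
Lemma re_dotDl x y z : re_dot (x + y) z = re_dot x z + re_dot y z.
Proof. by rewrite /re_dot linearDl ReD. Qed.
Lemma re_dotDr x y z : re_dot z (x + y) = re_dot z x + re_dot z y.
Proof. by rewrite !(re_dotC z) re_dotDl. Qed.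
Lemma re_dotZl (t : R) x y : re_dot (t%:C%C *: x) y = t * re_dot x y.
Proof. by rewrite /re_dot linearZl_LR ReM. Qed.
Lemma re_dotZr (t : R) x y : re_dot x (t%:C%C *: y) = t * re_dot x y.
Proof. by rewrite !(re_dotC x) re_dotZl. Qed.
Lemma re_dotNl x y : re_dot (- x) y = - re_dot x y.
Proof. by rewrite /re_dot linearNl ReN. Qed.
Lemma im_dotE x y : complex.Im (form x y) = re_dot (- 'i%C *: x) y.
Proof. by rewrite /re_dot linearZl_LR Re_mulN. Qed.

Lemma re_dot_ge0 x : 0 <= re_dot x x.
Proof.
have := dnorm_ge0 form x; rewrite /re_dot; move: (form x x) => [a b].
by rewrite lecE => /andP[].
Qed.
Lemma form_norm_ge0 x : 0 <= N x. Proof. exact: sqrtr_ge0. Qed.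
Lemma sqr_form_norm x : N x ^+ 2 = re_dot x x.
Proof. by rewrite sqr_sqrtr// re_dot_ge0. Qed.

Lemma re_dot_CS x y : `|re_dot x y| <= N x * N y.
Proof.
rewrite -(@ler_pXn2r _ 2)// ?nnegrE ?mulr_ge0 ?form_norm_ge0//.
rewrite real_normK ?num_real// exprMn !sqr_form_norm mulrC.
apply: discr_le => [|t]; first exact: re_dot_ge0.
have := re_dot_ge0 (x + t%:C%C *: y).
rewrite re_dotDl !re_dotDr !re_dotZl !re_dotZr (re_dotC y x); lra.
Qed.

Hypothesis hK : hilbert form.

(** The norm of [K] takes real values in [R[i]]; this rewriting carries its
    properties over to the real-valued [form_norm]. *)
Lemma normE x : `|x| = (N x)%:C%C.
Proof.
have h : `|x| ^+ 2 = form x x by rewrite hK sqrtCK.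
have nr : `|x| = (complex.Re `|x|)%:C%C by rewrite RRe_real// normr_real.
rewrite nr /form_norm -h nr -rmorphXn /= sqrtr_sqr ger0_norm//.
by rewrite -ler0c -nr.
Qed.

Lemma form_normD x y : N (x + y) <= N x + N y.
Proof. by rewrite -lecR rmorphD /= -!normE ler_normD. Qed.
Lemma form_normN x : N (- x) = N x.
Proof. by apply: complexI; rewrite -!normE normrN. Qed.
Lemma form_normB x y : N (x - y) = N (y - x).
Proof. by rewrite -form_normN opprB. Qed.
Lemma form_normZ (t : R) x : N (t%:C%C *: x) = `|t| * N x.
Proof.
apply: complexI; rewrite -normE normrZ rmorphM /= -normE; congr (_ * _).
by rewrite normc_def /= expr0n addr0 sqrtr_sqr.
Qed.
Lemma form_normi x : N (- 'i%C *: x) = N x.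
Proof.
apply: complexI; rewrite -!normE normrZ normrN normc_def /= expr0n add0r.
by rewrite expr1n sqrtr1 mul1r.
Qed.

(** Completeness with an explicit rate: the modulus [e] survives in the limit,
    which spares any further reasoning about convergence in [K]. *)
Lemma hilbert_complete (u : nat -> K) (e : nat -> R) :
  (forall n m, (n <= m)%N -> N (u m - u n) <= e n) -> e @ \oo --> (0 : R) ->
  exists l, forall n, N (l - u n) <= e n.
Proof.
move=> ue e0.
have /cauchy_cvg/cvg_ex[l ul] : cauchy (u @ \oo).
  apply: cauchy_exP => eps eps0.
  have epsE : eps = (complex.Re eps)%:C%C by rewrite RRe_real// gtr0_real.
  have r0 : 0 < complex.Re eps by rewrite -ltcR -epsE.
  have /cvgrPdist_lt/(_ _ r0)[n _ en] := e0.
  exists (u n); exists n => // m /= nm.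
  rewrite -ball_normE /ball_ /= distrC normE epsE ltcR.
  apply: (le_lt_trans (ue _ _ nm)).
  have := en n (leqnn n); rewrite sub0r normrN.
  by apply: le_lt_trans; rewrite ler_norm.
exists l => n; apply/ler_addgt0Pr => eps eps0.
have epsC : 0 < (eps%:C%C : R[i]) by rewrite ltcR.
have /cvgrPdist_lt/(_ _ epsC)[m _ um] := ul.
have := um (maxn m n) (leq_maxl _ _).
rewrite normE ltcR => h.
rewrite -(subrK (u (maxn m n)) l) -addrA (le_trans (form_normD _ _))//.
by rewrite [leRHS]addrC lerD ?ue ?leq_maxr// ltW.
Qed.

(** The error is relative to [x], so that bounds on [y] stay homogeneous in
    [x]; this is why [0] has to belong to [A]. *)
Lemma dense_approx (A : set K) : dense A -> A 0 -> forall x (e : R), 0 < e ->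
  exists2 y, A y & N (x - y) <= e * N x.
Proof.
move=> dA A0 x e e0; have [x0|xn0] := eqVneq (N x) 0.
  by exists 0 => //; rewrite subr0 x0 mulr0.
have r0 : 0 < e * N x by rewrite mulr_gt0// lt_def xn0 form_norm_ge0.
have rC : 0 < ((e * N x)%:C%C : R[i]) by rewrite ltcR.
have [||y [xy Ay]] := dA (ball x (e * N x)%:C%C).
- by exists x; exact: ballxx.
- exact: ball_open.
exists y => //; move: xy; rewrite -ball_normE /ball_ /= normE ltcR.
exact: ltW.
Qed.

End HilbertGeometry.

(** * Riesz representation and adjoints *)

Section Riesz.
Context {R : realType} {K : completeNormedModType R[i]}.
Variable form : {dot K for Num.conj}.
Hypothesis hK : hilbert form.
Local Notation N := (form_norm form).
Local Notation rdot := (re_dot form).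

Lemma cvg_half_expn : (fun n => (2^-1 : R) ^+ n) @ \oo --> (0 : R).
Proof. by apply: cvg_expr; rewrite ger0_norm// invf_lt1// ltr1n. Qed.

Lemma eq0_of_geometric_bound (a c : R) :
  (forall n, `|a| <= c * 2^-1 ^+ n) -> a = 0.
Proof.
move=> ac; apply: normr0_eq0; apply/eqP; rewrite eq_le normr_ge0 andbT.
have h : (fun n => c * 2^-1 ^+ n) @ \oo --> (c * 0).
  by apply: cvgM; [exact: cvg_cst | exact: cvg_half_expn].
rewrite mulr0 in h; rewrite -(cvg_lim _ h)//.
apply: limr_ge; first by apply/cvg_ex; exists 0.
exact: nearW.
Qed.

(** [J z = |z|^2 - 2 phi z] is bounded below, and by the parallelogram law a
    minimising sequence is Cauchy.  Its terms satisfy the Euler equation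
    [rdot z v = phi v] up to an error given by [discr_le], and so does the limit.
    Working with these approximate equations avoids the continuity of [J]. *)
Lemma riesz_re (phi : K -> R) (M : R) :
  {morph phi : x y / x + y} -> (forall (t : R) x, phi (t%:C%C *: x) = t * phi x) ->
  (forall x, `|phi x| <= M * N x) ->
  exists z, forall v, rdot z v = phi v.
Proof.
move=> phiD phiZ phiM.
pose J z := N z ^+ 2 - 2 * phi z.
have Jlow z : - M ^+ 2 <= J z.
  have := phiM z; rewrite ler_norml => /andP[_ h].
  have := sqr_ge0 (N z - M); rewrite /J; lra.
pose E := range J; pose m := inf E.
have hE : has_inf E.
  split; first by exists (J 0), 0.
  by exists (- M ^+ 2) => _ [z _ <-].
have Jm z : m <= J z by apply: ge_inf; [exact: hE.2 | exists z].
pose e n : R := 2^-1 ^+ n.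
have e0 n : 0 < e n by rewrite exprn_gt0// invr_gt0.
have /choice[u Ju] n : exists u, J u < m + e n ^+ 2 / 4.
  have [|_ [z _ <-] h] := @inf_adherent _ E (e n ^+ 2 / 4) _ hE.
    by rewrite divr_gt0// exprn_gt0.
  by exists z.
have J_line z v (t : R) :
    J (z + t%:C%C *: v) = J z + 2 * (rdot z v - phi v) * t + N v ^+ 2 * t ^+ 2.
  rewrite /J phiD phiZ !sqr_form_norm re_dotDl !re_dotDr !re_dotZl !re_dotZr.
  by rewrite (re_dotC form v z); ring.
have [n k nk|l ul] := hilbert_complete hK (u := u) (e := e) _ cvg_half_expn.
  rewrite -(@ler_pXn2r _ 2)// ?nnegrE ?form_norm_ge0 ?(ltW (e0 _))//.
  have ek : e k ^+ 2 <= e n ^+ 2.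
    rewrite ler_pXn2r ?nnegrE ?(ltW (e0 _))//.
    by rewrite ler_wiXn2l ?invr_ge0// invf_le1// ler1n.
  (* parallelogram law at the midpoint of [u n] and [u k] *)
  have h1 := J_line (u n) (u k - u n) 1.
  have h2 := J_line (u n) (u k - u n) 2^-1.
  rewrite rmorph1 scale1r addrC subrK in h1.
  have := Jm (u n + (2^-1 : R)%:C%C *: (u k - u n)); rewrite h2.
  have := Ju n; have := Ju k; lra.
exists l => v; apply/eqP; rewrite -subr_eq0; apply/eqP.
apply: (@eq0_of_geometric_bound _ (2 * N v)) => n; rewrite -/(e n).
have h : (rdot (u n) v - phi v) ^+ 2 <= N v ^+ 2 * (e n ^+ 2 / 4).
  apply: discr_le => [|t]; first exact: sqr_ge0.
  have := Jm (u n + t%:C%C *: v); rewrite J_line.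
  have := Ju n; lra.
have {}h : `|rdot (u n) v - phi v| <= N v * e n.
  rewrite -(@ler_pXn2r _ 2)// ?nnegrE ?mulr_ge0 ?form_norm_ge0 ?(ltW (e0 _))//.
  rewrite real_normK ?num_real// exprMn (le_trans h)//.
  by rewrite ler_wpM2l ?sqr_ge0//; have := sqr_ge0 (e n); lra.
have h' : `|rdot (l - u n) v| <= N v * e n.
  by rewrite (le_trans (re_dot_CS _ _ _))// mulrC ler_wpM2l ?form_norm_ge0 ?ul.
have -> : rdot l v - phi v = rdot (l - u n) v + (rdot (u n) v - phi v).
  by rewrite re_dotDl re_dotNl; ring.
rewrite (le_trans (ler_normD _ _))//; lra.
Qed.

Section Adjoint.
Variable U : {linear K -> K}.
Hypothesis bU : bounded_op U.

Lemma bounded_op_form_norm : exists2 M, 0 < M & forall x, N (U x) <= M * N x.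
Proof.
have [M UM] := bU; exists (`|M| + 1); first by rewrite ltr_wpDl.
move=> x; have := UM x; rewrite !(normE hK) -rmorphM /= lecR => /le_trans; apply.
by rewrite ler_wpM2r ?form_norm_ge0// (le_trans (ler_norm _))// lerDl.
Qed.

(** Riesz representation only matches the real parts; the imaginary parts are
    the real parts at [- i x]. *)
Lemma adjointP : is_adjoint form U (adjoint form U).
Proof.
have [M M0 UM] := bounded_op_form_norm.
have /choice[V UV] y : exists z, forall x, rdot z x = rdot (U x) y.
  apply: (@riesz_re _ (M * N y)) => [x x'|t x|x].
  - by rewrite linearD re_dotDl.
  - by rewrite linearZ re_dotZl.
  - rewrite (le_trans (re_dot_CS _ _ _))// mulrAC.
    by rewrite ler_wpM2r ?form_norm_ge0.
rewrite /adjoint; case: xgetP => [_ _ //|/(_ V)[]].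
move=> x y /=; apply/eqP; rewrite eq_complex.
have UV' x' : rdot (U x') y = rdot x' (V y) by rewrite (re_dotC form x') UV.
apply/andP; split; apply/eqP; first exact: UV'.
by rewrite !im_dotE -linearZ UV'.
Qed.

Let V := adjoint form U.

Lemma adjoint_swap x y : form x (U y) = form (V x) y.
Proof. by rewrite formC adjointP -formC. Qed.

Lemma re_dot_adjoint x y : rdot (U x) y = rdot x (V y).
Proof. by rewrite /re_dot adjointP. Qed.

Lemma adjoint_bounded : exists2 M, 0 < M & forall y, N (V y) <= M * N y.
Proof.
have [M M0 UM] := bounded_op_form_norm; exists M => // y.
have [->|Vy0] := eqVneq (N (V y)) 0; first by rewrite mulr_ge0 ?form_norm_ge0 ?ltW.
have Vy : 0 < N (V y) by rewrite lt_def Vy0 form_norm_ge0.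
rewrite -(ler_pM2l Vy) -expr2 sqr_form_norm -re_dot_adjoint.
rewrite (le_trans (ler_norm _))// (le_trans (re_dot_CS _ _ _))//.
by rewrite mulrA (mulrC (N (V y))) ler_wpM2r ?form_norm_ge0.
Qed.

End Adjoint.
End Riesz.

(** * Uniform boundedness and lower bounds for adjoints *)

Section UniformBoundedness.
Context {R : realType} {K : completeNormedModType R[i]}.
Variable form : {dot K for Num.conj}.
Hypothesis hK : hilbert form.
Local Notation N := (form_norm form).
Local Notation rdot := (re_dot form).

(** With [v] of norm [r] along [f], the values of [f] at [x + v] and [x - v]
    differ by [2 r |f|], so one of them is at least [r |f|] in size. *)
Lemma hump_step (x f : K) (r : R) : 0 <= r ->
  exists2 x', N (x' - x) <= r & r * N f <= `|rdot x' f|.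
Proof.
move=> r0; have [f0|fn0] := eqVneq (N f) 0.
  by exists x; rewrite ?subrr ?f0 ?mulr0// /form_norm linear0l sqrtr0.
pose v := (r / N f)%:C%C *: f.
have Nv : N v = r.
  by rewrite form_normZ// ger0_norm ?divfK// divr_ge0// form_norm_ge0.
have vf : rdot v f = r * N f.
  by rewrite re_dotZl -sqr_form_norm expr2 mulrA divfK.
have [|lt_x] := leP (r * N f) `|rdot (x + v) f|.
  by exists (x + v) => //; rewrite addrC addKr Nv.
exists (x - v); first by rewrite addrC addKr form_normN// Nv.
move: lt_x; rewrite !re_dotDl re_dotNl vf.
move: (rdot x f) (r * N f) => s t.
rewrite ltr_norml => /andP[_ h]; rewrite -normrN opprB (le_trans _ (ler_norm _))//.
lra.
Qed.

(** Gliding hump.  Were [A] unbounded, pick [f k] in [A] with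
    [|f k| > 2 k 3^k] and move by at most [3^- k] at step [k], so as to make
    [f k] large, using [hump_step].  All later moves add up to at most half of
    this step, so the limit [l] keeps [|rdot l (f k)| >= k]. *)
Lemma uniform_boundedness (A : set K) :
  (forall x, exists C, forall f, A f -> `|rdot x f| <= C) ->
  exists2 C, 0 < C & forall f, A f -> N f <= C.
Proof.
move=> Abnd; apply: contrapT => nA.
have /choice[f Af] k : exists f, A f /\ 2 * k%:R * 3 ^+ k < N f.
  apply: contrapT => nf; apply: nA; exists (Num.max 1 (2 * k%:R * 3 ^+ k)).
    by rewrite lt_max ltr01.
  move=> f Af; rewrite le_max; apply/orP; right; rewrite leNgt; apply/negP => h.
  by apply: nf; exists f.
pose r n : R := 3^-1 ^+ n.
have r0 n : 0 <= r n by rewrite exprn_ge0// invr_ge0.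
have rS n : r n = 3 * r n.+1 by rewrite /r exprS mulVKf// pnatr_eq0.
have /choice[g gP] (p : nat * K) :
    exists x', N (x' - p.2) <= r p.1 /\ r p.1 * N (f p.1) <= `|rdot x' (f p.1)|.
  by have [x' ? ?] := hump_step p.2 (f p.1) (r0 p.1); exists x'.
pose fix x n := if n is k.+1 then g (k, x k) else 0.
have xS n : N (x n.+1 - x n) <= r n by have [] := gP (n, x n).
have xf n : r n * N (f n) <= `|rdot (x n.+1) (f n)| by have [] := gP (n, x n).
(* [3 / 2 * r n] is the sum of all the steps from [n] on *)
pose e n : R := 3 / 2 * r n.
have xe n m : N (x (n + m)%N - x n) <= e n - e (n + m)%N.
  elim: m => [|m IH]; first by rewrite addn0 !subrr /form_norm linear0l sqrtr0.
  rewrite addnS -(subrK (x (n + m)%N) (x _.+1)) -addrA.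
  rewrite (le_trans (form_normD hK _ _))//.
  by have := xS (n + m)%N; have := rS (n + m)%N; rewrite /e in IH *; lra.
have [n m nm||l lx] := @hilbert_complete _ _ _ hK x e.
- rewrite -(subnKC nm) (le_trans (xe _ _))// lerBlDr lerDl.
  by rewrite mulr_ge0.
- rewrite -[X in _ --> X](mulr0 (3 / 2)).
  apply: cvgM; first exact: cvg_cst.
  by apply: cvg_expr; rewrite ger0_norm ?invr_ge0// invf_lt1// ltr1n.
have [C lC] := Abnd l.
have [k Ck] : exists k : nat, C < k%:R.
  by exists (Num.truncn C).+1; rewrite truncnS_gt.
have [Afk Nfk] := Af k.
have := lC _ Afk; apply/negP; rewrite -ltNge (lt_le_trans Ck)//.
have near_l : `|rdot (l - x k.+1) (f k)| <= 2^-1 * r k * N (f k).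
  rewrite (le_trans (re_dot_CS _ _ _))// ler_wpM2r ?form_norm_ge0//.
  by rewrite (le_trans (lx _))// /e (rS k); lra.
have far : k%:R <= 2^-1 * r k * N (f k).
  have : r k * (2 * k%:R * 3 ^+ k) <= r k * N (f k) by rewrite ler_wpM2l// ltW.
  have -> : r k * (2 * k%:R * 3 ^+ k) = 2 * k%:R.
    by rewrite mulrCA /r exprVn mulVf ?mulr1// expf_neq0// pnatr_eq0.
  lra.
have := xf k.
have -> : rdot (x k.+1) (f k) = rdot l (f k) - rdot (l - x k.+1) (f k).
  by rewrite re_dotDl re_dotNl; ring.
move/le_trans => /(_ _ (ler_normB _ _)); lra.
Qed.

(** The set to which uniform boundedness is applied is
    [{f | |U^* f| <= 1}], described without [U^*]. *)
Lemma adjoint_bounded_below (U : {linear K -> K}) : bounded_op U ->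
  (forall y, exists x, U x = y) ->
  exists2 C, 0 < C & forall y, N y <= C * N (adjoint form U y).
Proof.
move=> bU surjU; have UV := re_dot_adjoint hK bU.
have [x|C C0 AC] := @uniform_boundedness [set f | forall x, `|rdot (U x) f| <= N x].
  by have [x' <-] := surjU x; exists (N x') => f; exact.
exists C => // y; apply/ler_addgt0Pr => eps eps0.
(* [eps / C] keeps the scaling factor invertible when [U^* y] vanishes *)
pose s := N (adjoint form U y) + eps / C.
have s0 : 0 < s by rewrite ltr_wpDl ?form_norm_ge0// divr_gt0.
have : N ((s^-1)%:C%C *: y) <= C.
  apply: AC => x /=; rewrite re_dotZr normrM ger0_norm ?invr_ge0 ?(ltW s0)//.
  rewrite ler_pdivrMl// UV (le_trans (re_dot_CS _ _ _))// mulrC.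
  by rewrite ler_wpM2r ?form_norm_ge0// lerDl ltW// divr_gt0.
rewrite form_normZ// ger0_norm ?invr_ge0 ?(ltW s0)// ler_pdivrMl// mulrC mulrDr.
by rewrite (mulrCA C) divff ?mulr1// gt_eqF.
Qed.

End UniformBoundedness.

(** * From a dense set to the whole space *)

Section FrameExtension.
Context {d : measure_display} {Omega : measurableType d} {R : realType}.
Variable mu : {measure set Omega -> \bar R}.
Context {K : completeNormedModType R[i]}.
Variable form : {dot K for Num.conj}.
Hypothesis hK : hilbert form.
Local Notation N := (form_norm form).
Local Notation rdot := (re_dot form).
Variable F : Omega -> K.

Definition energy_density (f : K) (w : Omega) : R :=
  Normc.normc (form f (F w)) ^+ 2.

Lemma energy_densityE f w :
  energy_density f w = rdot f (F w) ^+ 2 + rdot (- 'i%C *: f) (F w) ^+ 2.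
Proof. by rewrite /energy_density sqr_normcE im_dotE. Qed.

Lemma energy_density_ge0 f w : (0 <= (energy_density f w)%:E)%E.
Proof. by rewrite lee_fin sqr_ge0. Qed.

Lemma cmeasurableE f : cmeasurable (fun w => form f (F w)) <->
  measurable_fun setT (fun w => rdot f (F w)) /\
  measurable_fun setT (fun w => rdot (- 'i%C *: f) (F w)).
Proof.
rewrite /cmeasurable.
suff -> : (fun w => complex.Im (form f (F w))) =
    (fun w => rdot (- 'i%C *: f) (F w)) by [].
by apply/funext => w; rewrite im_dotE.
Qed.

Lemma measurable_energy_density f : cmeasurable (fun w => form f (F w)) ->
  measurable_fun setT (fun w => (energy_density f w)%:E).
Proof.
move=> /cmeasurableE[mre mim]; apply/measurable_EFinP.
apply: (eq_measurable_fun _ (fun w _ => esym (energy_densityE f w))).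
by apply: measurable_funD; exact: measurable_funX.
Qed.

Lemma re_dot_cvg (u : nat -> K) f c x :
  (forall n, N (f - u n) <= c * 2^-1 ^+ n) ->
  rdot (u n) x @[n --> \oo] --> rdot f x.
Proof.
move=> fu; apply/subr_cvg0.
have e0 : (fun n => N x * c * 2^-1 ^+ n : R) @ \oo --> (0 : R).
  rewrite -[X in _ --> X](mulr0 (N x * c)).
  by apply: cvgM; [exact: cvg_cst | exact: cvg_half_expn].
apply: norm_cvg0; apply: (squeeze_cvgr _ (cvg_cst 0) e0).
apply: nearW => n; rewrite normr_ge0/= -re_dotNl -re_dotDl.
rewrite (le_trans (re_dot_CS _ _ _))// form_normB// mulrC -mulrA.
by rewrite ler_wpM2l ?form_norm_ge0.
Qed.

Variables (D : set K) (A B : R).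
Hypotheses (D_dense : dense D) (D0 : D 0).
Hypothesis D_meas : forall f, D f -> cmeasurable (fun w => form f (F w)).
Hypotheses (A_gt0 : 0 < A) (AB : A <= B).
Hypothesis D_bounds : forall f, D f ->
  ((A * N f ^+ 2)%:E <= \int[mu]_w (energy_density f w)%:E
     <= (B * N f ^+ 2)%:E)%E.

Lemma geometric_approx f : exists u : nat -> K,
  forall n, D (u n) /\ N (f - u n) <= N f * 2^-1 ^+ n.
Proof.
suff /choice[u uP] n : exists x, D x /\ N (f - x) <= N f * 2^-1 ^+ n by exists u.
have [|y Dy fy] := dense_approx hK D_dense D0 f (e := 2^-1 ^+ n).
  by rewrite exprn_gt0// invr_gt0.
by exists y; rewrite mulrC.
Qed.

Lemma form_norm_approx f g e : N (f - g) <= e * N f ->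
  N g <= (1 + e) * N f /\ (1 - e) * N f <= N g.
Proof.
move=> h; split.
  rewrite -(subrK f g) (le_trans (form_normD hK _ _))// form_normB//; lra.
have := form_normD hK (f - g) g; rewrite subrK; lra.
Qed.

Lemma dense_cmeasurable f : cmeasurable (fun w => form f (F w)).
Proof.
have [u uP] := geometric_approx f.
have mu_ n : _ /\ _ := (cmeasurableE _).1 (D_meas (uP n).1).
apply/cmeasurableE; split.
  apply: (@measurable_fun_cvg _ _ _ _ (fun n w => rdot (u n) (F w))) => [n|w _].
    by have [] := mu_ n.
  by apply: re_dot_cvg => n; exact: (uP n).2.
apply: (@measurable_fun_cvg _ _ _ _
  (fun n w => rdot (- 'i%C *: u n) (F w))) => [n|w _].
  by have [] := mu_ n.
apply: re_dot_cvg => n; rewrite -scalerBr form_normi//; exact: (uP n).2.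
Qed.

(** Fatou's lemma along [u n] tending to [f]; the relative error of the
    approximation gives [|u n| <= 2 |f|], whence the factor [4]. *)
Lemma dense_bessel f :
  (\int[mu]_w (energy_density f w)%:E <= (4 * B * N f ^+ 2)%:E)%E.
Proof.
have [u uP] := geometric_approx f.
have u_le n : (\int[mu]_w (energy_density (u n) w)%:E <= (4 * B * N f ^+ 2)%:E)%E.
  have /andP[_ h] := D_bounds (uP n).1; apply: (le_trans h); rewrite lee_fin.
  have := (uP n).2; rewrite mulrC => /form_norm_approx[h1 _].
  have {}h1 : N (u n) <= 2 * N f.
    rewrite (le_trans h1)// ler_wpM2r ?form_norm_ge0//.
    suff : 2^-1 ^+ n <= 1 :> R by lra.
    by rewrite exprn_ile1// ?invr_ge0// invf_le1// ler1n.
  have {}h1 : N (u n) ^+ 2 <= (2 * N f) ^+ 2.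
    by rewrite ler_pXn2r ?nnegrE ?mulr_ge0 ?form_norm_ge0.
  have -> : 4 * B * N f ^+ 2 = B * (2 * N f) ^+ 2 by ring.
  by rewrite ler_wpM2l// (le_trans _ AB)// ltW.
have lim_u w : (energy_density (u n) w)%:E @[n --> \oo] --> (energy_density f w)%:E.
  apply: cvg_EFin; first exact: nearW.
  rewrite /comp/= energy_densityE; under eq_fun do rewrite energy_densityE.
  have sqr_cvg (v : nat -> R) (l : R) :
      v @ \oo --> l -> v n ^+ 2 @[n --> \oo] --> l ^+ 2.
    by rewrite expr2; under eq_fun do rewrite expr2; move=> vl; exact: cvgM.
  apply: cvgD; apply: sqr_cvg.
    by apply: re_dot_cvg => n; exact: (uP n).2.
  by apply: re_dot_cvg => n; rewrite -scalerBr form_normi//; exact: (uP n).2.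
under eq_integral => w _ do rewrite -((cvg_limn_einf_sup (lim_u w)).1).
apply: le_trans.
  apply: (@fatou _ _ _ mu setT measurableT (fun n w => (energy_density (u n) w)%:E)).
    by move=> n; apply: measurable_energy_density; exact: D_meas (uP n).1.
  by move=> n w _; exact: energy_density_ge0.
rewrite limn_einf_lim; apply: lime_le; first exact: is_cvg_einfs.
apply: nearW => n; apply: le_trans (u_le n).
by apply: ereal_inf_lbound; exists n => /=.
Qed.

(** The pointwise form of [|b|^2 <= 2 |a|^2 + 2 |b - a|^2], which does the work
    of Minkowski's inequality. *)
Lemma energy_density_le f g w :
  energy_density g w <= 2 * energy_density f w + 2 * energy_density (g - f) w.
Proof.
rewrite !energy_densityE scalerBr !re_dotDl !re_dotNl.
move: (rdot f (F w)) (rdot g (F w)) => a b.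
move: (rdot (- 'i%C *: f) (F w)) (rdot (- 'i%C *: g) (F w)) => x y.
have := sqr_ge0 (2 * a - b); have := sqr_ge0 (2 * x - y); lra.
Qed.

(** Approximate [f] by [g] in [D] with relative error [A / (8 B)].  This is at
    most [1 / 8], so [|g| >= |f| / 2], and the energy of [g - f] is at most
    [A / 16 |f|^2]; hence
    [A / 4 |f|^2 <= energy of g <= 2 (energy of f) + A / 8 |f|^2]. *)
Lemma dense_frame_lower f :
  ((A / 16 * N f ^+ 2)%:E <= \int[mu]_w (energy_density f w)%:E)%E.
Proof.
have B0 : 0 < B := lt_le_trans A_gt0 AB.
have [|g Dg fg] := dense_approx hK D_dense D0 f (e := A / (8 * B)).
  by rewrite divr_gt0// mulr_gt0.
have bessel := dense_bessel (g - f).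
have /andP[lower _] := D_bounds Dg.
have : (\int[mu]_w (energy_density g w)%:E <=
    2%:E * \int[mu]_w (energy_density f w)%:E
    + 2%:E * \int[mu]_w (energy_density (g - f) w)%:E)%E.
  have mE h := measurable_energy_density (dense_cmeasurable h).
  rewrite -!ge0_integralZl_EFin//; try by move=> w _; exact: energy_density_ge0.
  rewrite -ge0_integralD//; last 4 first.
  - by move=> w _; rewrite mule_ge0// energy_density_ge0.
  - exact: measurable_funeM.
  - by move=> w _; rewrite mule_ge0// energy_density_ge0.
  - exact: measurable_funeM.
  apply: ge0_le_integral => //.
  - by move=> w _; exact: energy_density_ge0.
  - by apply: emeasurable_funD; exact: measurable_funeM.
  - by move=> w _; rewrite -!EFinM -EFinD lee_fin energy_density_le.
have fin h : (\int[mu]_w (energy_density h w)%:E)%E \is a fin_num.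
  rewrite ge0_fin_numE; last by apply: integral_ge0 => w _; exact: energy_density_ge0.
  exact: le_lt_trans (dense_bessel h) (ltry _).
move: bessel lower (fin f) (fin g) (fin (g - f)).
move: (integral _ _ _) (integral _ _ _) (integral _ _ _) => [x| |] [y| |] [z| |]//.
rewrite -!EFinM -EFinD !lee_fin => bessel lower _ _ _ split.
move: bessel; rewrite form_normB// => bessel.
have e18 : A / (8 * B) <= 1 / 8.
  by rewrite ler_pdivrMr ?mulr_gt0// (_ : 1 / 8 * (8 * B) = B)//; field.
have n0 := form_norm_ge0 form f.
have g_ge : 2^-1 * N f <= N g.
  rewrite (le_trans _ (form_norm_approx fg).2)// ler_wpM2r//; lra.
have {}lower : A * (2^-1 * N f) ^+ 2 <= y.
  rewrite (le_trans _ lower)// ler_wpM2l ?(ltW A_gt0)//.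
  by rewrite ler_pXn2r ?nnegrE ?mulr_ge0 ?form_norm_ge0 ?invr_ge0.
have {}bessel : z <= A / 16 * N f ^+ 2.
  have h : N (f - g) ^+ 2 <= (A / (8 * B) * N f) ^+ 2.
    by rewrite ler_pXn2r ?nnegrE ?(le_trans _ fg) ?form_norm_ge0.
  apply: (le_trans bessel).
  apply: (@le_trans _ _ (4 * B * (A / (8 * B) * N f) ^+ 2)).
    by rewrite ler_wpM2l// mulr_ge0// ltW.
  have -> : 4 * B * (A / (8 * B) * N f) ^+ 2 = A / 2 * (A / (8 * B)) * N f ^+ 2.
    by field; rewrite gt_eqF.
  rewrite ler_wpM2r ?sqr_ge0//.
  rewrite (le_trans (ler_wpM2l _ e18))//; last lra.
  by rewrite divr_ge0// ltW.
move: lower; rewrite exprMn => lower; have := sqr_ge0 (N f).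
have : (2^-1 : R) ^+ 2 = 4^-1 by field.
move=> h; rewrite {}h in lower; lra.
Qed.

End FrameExtension.

(** * Frames and their images under an operator *)

Section FrameImage.
Context {d : measure_display} {Omega : measurableType d} {R : realType}.
Variable mu : {measure set Omega -> \bar R}.
Context {K : completeNormedModType R[i]}.
Variable form : {dot K for Num.conj}.
Hypothesis hK : hilbert form.
Local Notation N := (form_norm form).

Lemma continuous_frame_dense (F : Omega -> K) (D : set K) (A B : R) :
  dense D -> D 0 -> (forall f, D f -> cmeasurable (fun w => form f (F w))) ->
  0 < A -> A <= B ->
  (forall f, D f -> ((A * N f ^+ 2)%:E
     <= \int[mu]_w (Normc.normc (form f (F w)) ^+ 2)%:E
     <= (B * N f ^+ 2)%:E)%E) ->
  continuous_frame mu form F.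
Proof.
move=> dD D0 mD A0 AB bD; split=> [f|]; first exact: dense_cmeasurable mD f.
exists (A / 16), (4 * B); split; [by rewrite divr_gt0 | lra |] => f.
apply/andP; split; first exact: (dense_frame_lower hK dD D0 mD A0 AB bD).
exact: (dense_bessel hK dD D0 mD A0 AB bD).
Qed.

(** Surjectivity of [U] enters through the lower frame bound, by making [U^*]
    bounded below. *)
Lemma continuous_frame_comp (F : Omega -> K) (U : {linear K -> K}) :
  bounded_op U -> (forall y, exists x, U x = y) ->
  continuous_frame mu form F -> continuous_frame mu form (fun w => U (F w)).
Proof.
move=> bU surjU [mF [A [B [A0 AB bF]]]].
pose V := adjoint form U.
have UV f w : form f (U (F w)) = form (V f) (F w).
  exact: adjoint_swap.
have [M M0 VM] := adjoint_bounded hK bU.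
have [C C0 VC] := adjoint_bounded_below hK bU surjU.
split=> [f|].
  by rewrite (_ : (fun w => _) = fun w => form (V f) (F w))//; apply/funext => w.
exists (A / C ^+ 2), (Num.max (A / C ^+ 2) (B * M ^+ 2)); split.
- by rewrite divr_gt0// exprn_gt0.
- by rewrite le_max lexx.
- move=> f; under eq_integral => w _ do rewrite UV.
  have /andP[lower upper] := bF (V f).
  apply/andP; split; [apply: (le_trans _ lower) | apply: (le_trans upper)].
    rewrite lee_fin -mulrA ler_wpM2l ?(ltW A0)// ler_pdivrMl ?exprn_gt0//.
    by rewrite -exprMn ler_pXn2r ?nnegrE ?mulr_ge0 ?form_norm_ge0 ?(ltW C0).
  have B0 : 0 <= B by rewrite (le_trans _ AB)// ltW.
  rewrite lee_fin; apply: (@le_trans _ _ (B * M ^+ 2 * N f ^+ 2)).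
    rewrite -mulrA -exprMn ler_wpM2l//.
    by rewrite ler_pXn2r ?nnegrE ?mulr_ge0 ?form_norm_ge0 ?(ltW M0).
  by rewrite ler_wpM2r ?sqr_ge0// le_max lexx orbT.
Qed.

Lemma is_frame_operator_comp (F : Omega -> K) (S : K -> K) (U : {linear K -> K}) :
  bounded_op U -> is_frame_operator mu form F S ->
  is_frame_operator mu form (fun w => U (F w)) (U \o S \o adjoint form U).
Proof.
move=> bU FS f g; have UV := adjointP hK bU.
have -> : (fun w => form f (U (F w)) * form (U (F w)) g) =
    (fun w => form (adjoint form U f) (F w) * form (F w) (adjoint form U g)).
  by apply/funext => w; rewrite (adjoint_swap hK bU) UV.
by rewrite /= UV; exact: FS.
Qed.
End FrameImage.

(** * The image of a frame in an n-Hilbert space *)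

Theorem theorem3p10 (R : realType) (n : nat) (n_ge2 : (2 <= n)%N)
  (H1 : lmodType R[i]) (dimH1 : dim_ge H1 n)
  (ip : nInnerProduct n H1) (H1_complete : nhilbert ip)
  (a : n.-1.-tuple H1) (a_indep : lin_indep a)
  (HF : completeNormedModType R[i]) (ipF : {dot HF for Num.conj})
  (j : {linear quot_span a -> HF})
  (HF_completion : is_completion ipF (quot_form ip (a := a)) j)
  (d : measure_display) (Omega : measurableType d)
  (mu : {measure set Omega -> \bar R})
  (F : Omega -> H1) (F_frame : continuous_frame mu (form_at ip a) F)
  (SC : HF -> HF)
  (SC_frame_op : is_frame_operator mu ipF (fun w => j (quot_class a (F w))) SC)
  (U : {linear HF -> HF}) (U_bounded : bounded_op U) (U_inv : bijective U) :
  continuous_frame mu ipF (fun w => U (j (quot_class a (F w)))) /\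
  is_frame_operator mu ipF (fun w => U (j (quot_class a (F w))))
    (U \o SC \o adjoint ipF U).
Proof.
have [hHF jq j_dense] := HF_completion.
have jE x y : ipF (j (quot_class a x)) (j (quot_class a y)) = form_at ip a x y.
  by rewrite jq quot_formE.
split; last exact: is_frame_operator_comp.
apply: continuous_frame_comp => //.
  by have [Ui _ UiK] := U_inv; move=> y; exists (Ui y).
have [mF [A [B [A0 AB bF]]]] := F_frame.
apply: (continuous_frame_dense hHF j_dense) A0 AB _.
- by exists 0; rewrite ?linear0.
- move=> _ [u _ <-]; rewrite -(quot_reprK u).
  suff -> : (fun w => ipF (j (quot_class a (quot_repr u))) (j (quot_class a (F w))))
      = (fun w => form_at ip a (quot_repr u) (F w)) by exact: mF.
  by apply/funext => w; exact: jE.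
- move=> _ [u _ <-]; rewrite -(quot_reprK u).
  under eq_integral => w _ do rewrite jE.
  by rewrite /form_norm jE; exact: bF.
Qed.
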